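(* Let $K=\mathbb{C}(x_1,\dots,x_n)$, let $\Omega\neq 0$ be an $(n-1)$-form over $K$ that admits no rational first integral, let $L$ be a finite Galois extension of $K$ with group $G=Gal(L:K)$, and let $\omega\in\mathcal{I}(\Omega)$, with images under $G$ organized in blocks $\mathcal{B}_1,\dots,\mathcal{B}_r$ with spans of dimension $s>1$ over $L$, as described in the context. Then there is an intermediate field $F$ of the extension $L\supseteq K$ such that $F$ is Galois over $K$, $\omega\in F'$, and the representation of $Gal(F:K)$ in $GL(rs,\mathbb{C})$ (given by its action on the basis $\omega_{1,1},\dots,\omega_{1,s},\dots,\omega_{r,1},\dots,\omega_{r,s}$) is faithful. Thus $Gal(F:K)$ is isomorphic to a finite subgroup of $GL(rs,\mathbb{C})$.
   Context: $L'$ (and likewise $F'$, $M'$) denotes the space of one-forms $\sum_i a_i\,dx_i$ with coefficients $a_i$ in $L$ (resp. $F$, $M$); derivations extend uniquely to $L$, and $G$ acts on forms coefficientwise and commutes with $d$. $\mathcal{I}(\Omega)$ is the set of all $0\neq\omega\in L'$ for which there is $\alpha\in L'$ with $\omega\wedge\Omega=0$, $d\omega=\alpha\wedge\omega$, $d\alpha=0$. A rational first integral of $\Omega$ is a non-constant $\phi\in K$ with $d\phi\wedge\Omega=0$. Block setting: the set of distinct images of $\omega=\omega_{1,1}$ under $G$ is partitioned into blocks $\mathcal{B}_k=\{\omega_{k,1},\dots,\omega_{k,q}\}$, $1\le k\le r$, which are the images of $\mathcal{B}_1$ under the action of $G$ (so $G$ permutes the blocks). $V_k=\langle\mathcal{B}_k\rangle_L$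 has dimension $s$ over $L$, with $L$-basis $\omega_{k,1},\dots,\omega_{k,s}$, and the span $V$ of all images is the direct sum $V=V_1\oplus\dots\oplus V_r$, with $rs\le n-1$. Let $G_1=\{\sigma\in G:\ \sigma(\mathcal{B}_k)=\mathcal{B}_k,\ 1\le k\le r\}$, with fixed field $M$. For each $k$ there is a closed form $\alpha_k\in M'$ such that $d\omega_{k,j}=\alpha_k\wedge\omega_{k,j}$ for all $\omega_{k,j}\in\mathcal{B}_k$. (When $\mathcal{I}(\Omega)$ contains a closed form $\omega$, one takes a single block consisting of all images of $\omega$, and $\alpha_1=0$.) In this setting the matrix $A(\sigma)$ of the action of $\sigma\in G$ on the basis $\omega_{1,1},\dots,\omega_{r,s}$ of $V$ has all entries in $\mathbb{C}$, so that $G$ has a linear representation in $GL(rs,\mathbb{C})$. *)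

(* Defs.v *)
From HB Require Import structures.
From mathcomp Require Import all_boot all_order all_fingroup all_algebra.
From mathcomp Require Import all_solvable all_field all_character.
From mathcomp Require Import fraction generic_quotient finmap complex reals.
From mathcomp Require Import mpoly.

Set Implicit Arguments.
Unset Strict Implicit.
Unset Printing Implicit Defensive.

Import GRing.Theory.
Local Open Scope ring_scope.

(* The field C(x_1, ..., x_n), where C = R[i] for a model R of the reals. *)
Notation ratfun R n := {fraction {mpoly R[i][n]}}.

Section RationalFunctions.
Variables (R : realType) (n : nat).
Implicit Types (f : ratfun R n) (i : 'I_n).

Definition ratC (c : R[i]) : ratfun R n := tofrac (mpolyC n c).

(* The partial derivative d/dx_i, by the quotient rule applied to an arbitrary
   representative p/q of f. *)
Definition partial i f : ratfun R n :=
  let p := \n_(repr f) in let q := \d_(repr f) in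
  tofrac (mderiv i p * q - p * mderiv i q) / tofrac q ^+ 2.

(* Such a D exists and is unique when L is a finite extension: it is the
   extension of d/dx_i to L. *)
Definition extends_partial (L : fieldExtType (ratfun R n)) i (D : L -> L) :=
  [/\ forall a b, D (a + b) = D a + D b,
      forall a b, D (a * b) = D a * b + a * D b &
      forall f, D f%:A = (partial i f)%:A].

End RationalFunctions.

(* Differential forms in dx_1, ..., dx_n over a field E with derivations
   D_1, ..., D_n.
   - A one-form \sum_i a_i dx_i is the row vector of the a_i.
   - A two-form is the alternating matrix whose entries (i, j), i < j, are its
     coefficients on dx_i /\ dx_j.
   - An (n-1)-form is the row vector of its coefficients on
     dx_1 /\ ... /\ dx_(i-1) /\ dx_(i+1) /\ ... /\ dx_n.
   - An n-form is its coefficient on dx_1 /\ ... /\ dx_n. *)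
Section Forms.
Variables (E : fieldType) (n : nat) (D : 'I_n -> E -> E).
Implicit Types (a w : 'rV[E]_n) (Omega : 'rV[E]_n).

Definition d0 (f : E) : 'rV[E]_n := \row_i D i f.

Definition d1 w : 'M[E]_n := \matrix_(i, j) (D i (w 0 j) - D j (w 0 i)).

Definition wedge1 a w : 'M[E]_n :=
  \matrix_(i, j) (a 0 i * w 0 j - a 0 j * w 0 i).

(* The index i starts at 0, so that dx_i has to move past i factors. *)
Definition wedge_top w Omega : E := \sum_(i < n) (-1) ^+ i * (w 0 i * Omega 0 i).

Definition integrable_form Omega w :=
  w != 0 /\
  exists a, [/\ wedge_top w Omega = 0, d1 w = wedge1 a w & d1 a = 0].

End Forms.

Definition rational_first_integral (R : realType) (n : nat)
    (Omega : 'rV[ratfun R n]_n) (phi : ratfun R n) :=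
  (forall c : R[i], phi <> ratC n c) /\
  wedge_top (d0 (@partial R n) phi) Omega = 0.

Section GaloisForms.
Variables (F0 : fieldType) (L : splittingFieldType F0) (n : nat).
Implicit Types (w : 'rV[L]_n).

Definition form_over (M : {subfield L}) w := forall i, w 0 i \in M.

Definition gal_form (E : {subfield L}) (sigma : gal_of E) w : 'rV[L]_n :=
  map_mx sigma w.

Section Blocks.
Variables (r q s : nat) (w : 'I_r -> 'I_q -> 'rV[L]_n).

Definition block k : {fset 'rV[L]_n} := [fset w k j | j in 'I_q]%fset.

Definition gal_block (sigma : gal_of {:L}) k : {fset 'rV[L]_n} :=
  [fset gal_form sigma v | v in block k]%fset.

(* The L-span of the k-th block is the row space of this matrix. *)
Definition block_mx_span k : 'M[L]_(q, n) := \matrix_(j < q) w k j.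

Definition block_stabilizer : {set gal_of {:L}} :=
  [set sigma in 'Gal({:L} / 1)%g | [forall k, gal_block sigma k == block k]].

Record block_setting (D : 'I_n -> L -> L) (omega : 'rV[L]_n) (le_sq : (s <= q)%N)
    : Prop := BlockSetting {
  block_images : forall v,
    (exists2 sigma, sigma \in 'Gal({:L} / 1)%g & v = gal_form sigma omega) <->
    (exists k j, v = w k j);
  block_inj : forall k j k' j', w k j = w k' j' -> k = k' /\ j = j';
  block_first : forall (k : 'I_r) (j : 'I_q),
    k = 0%N :> nat -> j = 0%N :> nat -> w k j = omega;
  block_orbit : forall k1 k : 'I_r, k1 = 0%N :> nat ->
    exists2 sigma, sigma \in 'Gal({:L} / 1)%g & gal_block sigma k1 = block k;
  block_perm : forall sigma, sigma \in 'Gal({:L} / 1)%g ->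
    forall k, exists l, gal_block sigma k = block l;
  block_dim : forall k, \rank (block_mx_span k) = s;
  block_basis : forall k,
    (\matrix_(j < s) w k (widen_ord le_sq j) :=: block_mx_span k)%MS;
  block_direct : mxdirect (\sum_(k < r) <<block_mx_span k>>)%MS;
  block_bound : (r * s <= n.-1)%N;
  block_form : forall k, exists a,
    [/\ form_over (fixedField block_stabilizer) a, d1 D a = 0 &
        forall j, d1 D (w k j) = wedge1 a (w k j)]
}.

End Blocks.
End GaloisForms.

(* rho describes the action of Gal(E : C(x_1, ..., x_n)) on the w k j, j < s, with
   the pairs (k, j) in lexicographic order. The coordinates of the image of a
   basis vector form a row of rho sigma; the product of automorphisms being
   composition from left to right, this is multiplicative. *)
Definition acts_on_basis (R : realType) (n : nat)
    (L : splittingFieldType (ratfun R n)) (E : {subfield L}) (r q s : nat)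
    (w : 'I_r -> 'I_q -> 'rV[L]_n) (le_sq : (s <= q)%N)
    (rho : gal_of E -> 'M[R[i]]_(r * s)) :=
  forall sigma, sigma \in 'Gal(E / 1)%g -> forall (k : 'I_r) (j : 'I_s),
    gal_form sigma (w k (widen_ord le_sq j)) =
    \sum_(l < r) \sum_(m < s)
      (ratC n (rho sigma (mxvec_index k j) (mxvec_index l m)))%:A
        *: w l (widen_ord le_sq m).

Definition finite_GL_subgroup (C : fieldType) d (H : {fset 'M[C]_d}) :=
  [/\ {in H, forall A, A \in unitmx}, 1%:M \in H,
      {in H &, forall A B, A *m B \in H} & {in H, forall A, invmx A \in H}].

Definition isog_GL_subgroup (gT : finGroupType) (G : {group gT})
    (C : fieldType) d (H : {fset 'M[C]_d}) :=
  exists f : gT -> 'M[C]_d,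
    [/\ {in G &, {morph f : x y / (x * y)%g >-> x *m y}},
        {in G &, injective f} & forall A, A \in H <-> exists2 x, x \in G & A = f x].

(* Main.v *)
Require Import Defs.
From HB Require Import structures.
From mathcomp Require Import all_boot all_order all_fingroup all_algebra.
From mathcomp Require Import all_solvable all_field all_character.
From mathcomp Require Import fraction generic_quotient finmap complex reals.
From mathcomp Require Import mpoly ring.
From Stdlib Require Import Classical_Prop.

Set Implicit Arguments.
Unset Strict Implicit.
Unset Printing Implicit Defensive.

Import GRing.Theory.
Local Open Scope ring_scope.

(** The proof rests on one rigidity fact: an element f of L with
df /\ Omega = 0 lies in C.  The operator X f := df /\ Omega is a derivation of
L which preserves K, and if X f = 0 then X kills every coefficient of the
minimal polynomial of f over K ([derivation_minPoly_coef]).  Without a rational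
first integral these coefficients lie in C, so f is algebraic over the
algebraically closed field C ([constant_of_wedge_eq0]).

Inside a block, all forms satisfy the same equation dw = alpha /\ w.  If such a
form is sum_m a_m v_m in terms of an L-basis (v_m) of the span, subtracting the
equations leaves sum_m da_m /\ v_m = 0, which forces every da_m into the span of
the v_m ([d0_coordinate_sub], an instance of Cartan's lemma).  All v_m are
conjugates of omega, hence orthogonal to Omega; so da_m /\ Omega = 0 and a_m is
a constant ([block_constant_coordinates]).  As the Galois group permutes the
images of omega ([block_image]), it acts on the chosen basis of V by matrices
over C.

The rest is pure Galois theory ([faithful_galois_descent]).  Let B be the matrix
of the basis vectors.  The automorphisms fixing B form a normal subgroup N of
Gal(L : K), because the C-linear combinations of the rows of B are stable under
Gal(L : K) and fixed by N.  With F the fixed field of N, the entries of B lie in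
F, and an element of Gal(F : K) acting trivially on B lifts to an element of N,
so it is trivial. *)

(** * Algebraic elements killed by a derivation *)

Lemma closed_field_root_image (C : closedFieldType) (E : fieldType)
    (iota : {rmorphism C -> E}) (p : {poly E}) (x : E) :
    p != 0 -> (forall i, exists c, p`_i = iota c) -> root p x ->
  exists c, x = iota c.
Proof.
move=> p_neq0 p_C px0.
have [c p_c] := fin_all_exists (fun i : 'I_(size p) => p_C i).
pose p0 := \poly_(i < size p) (if insub i is Some j then c j else 0).
have Dp : p = map_poly iota p0.
  apply/polyP=> i; rewrite coef_map coef_poly.
  case: ltnP => [lt_i | le_i]; last by rewrite /= rmorph0 nth_default.
  by rewrite /= insubT; exact: p_c (Ordinal lt_i).
have [rs Dp0] := closed_field_poly_normal p0.
have lead_neq0 : iota (lead_coef p0) != 0.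
  rewrite fmorph_eq0 lead_coef_eq0; apply: contraNneq p_neq0 => p0_0.
  by rewrite Dp p0_0 rmorph0.
move: px0; rewrite Dp Dp0 map_polyZ rmorph_prod rootZ //.
under eq_bigr do rewrite /= map_polyXsubC.
rewrite -(big_map iota xpredT (fun z => 'X - z%:P)) root_prod_XsubC.
by case/mapP=> c' _ ->; exists c'.
Qed.

(** Let p be the minimal polynomial of f and Xp the polynomial obtained by
applying X to the coefficients of p.  As X f = 0, the Leibniz rule gives
Xp(f) = X(p(f)) = 0.  But p is monic and X 1 = 0, so Xp has a smaller degree than
p, and minimality of p makes it zero. *)
Lemma derivation_minPoly_coef (F0 : fieldType) (L : fieldExtType F0)
    (X : L -> L) (XD : {morph X : a b / a + b})
    (XM : forall a b, X (a * b) = X a * b + a * X b)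
    (X1 : forall a, a \in 1%VS -> X a \in 1%VS) (f : L) :
  X f = 0 -> forall i, X (minPoly 1 f)`_i = 0.
Proof.
move=> Xf; set p := minPoly _ _.
have X0 : X 0 = 0 by apply: (addrI (X 0)); rewrite -XD !addr0.
have X1_0 : X 1 = 0.
  by apply: (addrI (X 1)); rewrite addr0 -{3}[1]mulr1 XM mulr1 mul1r.
have Xexp m : X (f ^+ m) = 0.
  by elim: m => [|m IHm]; rewrite ?X1_0 // exprS XM Xf IHm mul0r mulr0 addr0.
have p1 : p \is a polyOver 1%AS := minPolyOver _ _.
have p_mon : p \is monic := monic_minPoly _ _.
have p_gt0 : (0 < size p)%N by rewrite size_minPoly.
(* The leading coefficient of p is left out, which makes the drop in degree
   visible. *)
pose Xp := \poly_(i < (size p).-1) X p`_i.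
have coefXp i : Xp`_i = X p`_i.
  rewrite coef_poly; case: ltnP => //; rewrite leq_eqVlt => /predU1P[<-|].
    by rewrite -lead_coefE (monicP p_mon) X1_0.
  by rewrite prednK // => ?; rewrite nth_default ?X0.
suff Xp0 : Xp = 0 by move=> i; rewrite -coefXp Xp0 coef0.
apply/eqP/negPn/negP=> Xp_neq0.
have Xp1 : Xp \is a polyOver 1%AS.
  by apply/polyOverP=> i; rewrite coefXp X1 // (polyOverP p1).
have Xpf : root Xp f.
  have Xsum := big_morph X XD X0.
  apply/rootP; rewrite -[RHS]X0 -(minPolyxx 1%AS f) -/p.
  have le_szp : (size p <= (size p).-1.+1)%N by rewrite prednK.
  rewrite (horner_coef_wide f (size_poly _ _)) (horner_coef_wide f le_szp) Xsum.
  rewrite big_ord_recr /=.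
  rewrite -lead_coefE (monicP p_mon) mul1r Xexp addr0.
  by apply: eq_bigr => i _; rewrite XM Xexp mulr0 addr0 coefXp.
have := dvdp_leq Xp_neq0 (minPoly_dvdp Xp1 Xpf).
rewrite -/p leqNgt => /negP[].
by rewrite (leq_ltn_trans (size_poly _ _)) // prednK.
Qed.

(** The rigidity fact: the absence of first integrals in K excludes
non-constant ones in every finite extension of K. *)
Lemma constant_of_wedge_eq0 (R : realType) (n : nat) (Omega : 'rV[ratfun R n]_n)
    (L : fieldExtType (ratfun R n)) (D : 'I_n -> L -> L) (f : L) :
    (~ exists phi : ratfun R n, rational_first_integral Omega phi) ->
    (forall i, extends_partial i (D i)) ->
    wedge_top (d0 D f) (map_mx (in_alg L) Omega) = 0 ->
  exists c, f = (ratC n c)%:A.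
Proof.
move=> no_int extD Xf0.
pose X a := wedge_top (d0 D a) (map_mx (in_alg L) Omega).
have XD : {morph X : a b / a + b}.
  move=> a b; rewrite /X /wedge_top -big_split; apply: eq_bigr => i _ /=.
  by have [DD _ _] := extD i; rewrite !mxE DD mulrDl mulrDr.
have XM a b : X (a * b) = X a * b + a * X b.
  rewrite /X /wedge_top mulr_suml mulr_sumr -big_split; apply: eq_bigr => i _ /=.
  by have [_ DM _] := extD i; rewrite !mxE DM; ring.
(* On K, the derivation X is the one that defines rational first integrals. *)
have XA h : X h%:A = (wedge_top (d0 (@partial R n) h) Omega)%:A.
  rewrite -[RHS]/(in_alg L _) rmorph_sum; apply: eq_bigr => i _ /=.
  have [_ _ DA] := extD i; rewrite !mxE DA.
  by rewrite -!in_algE !rmorphM rmorphXn rmorphN rmorph1.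
pose iota : {rmorphism R[i] -> L} := in_alg L \o (@tofrac _ \o @mpolyC n R[i]).
apply: (closed_field_root_image (iota := iota) (p := minPoly 1 f));
  last exact: root_minPoly.
  exact/monic_neq0/monic_minPoly.
move=> i; have /polyOverP/(_ i)/vlineP[h Dh] := minPolyOver 1%AS f.
have : X (minPoly 1 f)`_i = 0.
  apply: (derivation_minPoly_coef XD XM _ Xf0) => _ /vlineP[h' ->].
  by rewrite XA; exact: memvZ (mem1v _).
rewrite Dh XA => /eqP; rewrite -in_algE fmorph_eq0 => /eqP Xh.
apply: NNPP => no_c; apply: no_int; exists h; split=> // c Dc.
by apply: no_c; exists c; rewrite Dc.
Qed.

(** * Coordinates of forms that share the same alpha *)

(** Cartan's lemma: with v_m and u_m the rows of V and U, the hypothesis says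
that sum_m u_m /\ v_m = 0.  A right inverse N of V gives U^T = V^T (U N). *)
Lemma alternating_pairing_sub (E : fieldType) (s n : nat) (U V : 'M[E]_(s, n)) :
  row_free V -> U^T *m V = V^T *m U -> (U <= V)%MS.
Proof.
move=> /row_freeP[N VN] UV; apply/submxP; exists (U *m N)^T.
by apply: trmx_inj; rewrite trmx_mul trmxK mulmxA -UV -mulmxA VN mulmx1.
Qed.

Lemma wedge_top_sub (E : fieldType) (n s : nat) (V : 'M[E]_(s, n))
    (u Omega : 'rV[E]_n) :
    (forall m, wedge_top (row m V) Omega = 0) -> (u <= V)%MS ->
  wedge_top u Omega = 0.
Proof.
pose c : 'cV[E]_n := \col_i ((-1) ^+ i * Omega 0 i).
have wedgeE v : wedge_top v Omega = (v *m c) 0 0.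
  by rewrite mxE; apply: eq_bigr => i _; rewrite mxE mulrCA.
move=> V0 /submxP[a ->]; rewrite wedgeE -mulmxA.
suff ->: V *m c = 0 by rewrite mulmx0 mxE.
apply/row_matrixP=> m; rewrite row_mul row0; apply/rowP=> j.
by rewrite ord1 -wedgeE V0 mxE.
Qed.

(** Expanding d(sum_m a_m v_m) by the Leibniz rule, the terms a_m dv_m account
for the whole of alpha /\ sum_m a_m v_m; what remains is
sum_m da_m /\ v_m = 0. *)
Lemma d0_coordinate_sub (E : fieldType) (n s : nat) (D : 'I_n -> E -> E)
    (V : 'M[E]_(s, n)) (a : 'rV[E]_s) (alpha : 'rV[E]_n) :
    (forall i, {morph D i : x y / x + y}) ->
    (forall i x y, D i (x * y) = D i x * y + x * D i y) ->
    row_free V ->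
    (forall m, d1 D (row m V) = wedge1 alpha (row m V)) ->
    d1 D (a *m V) = wedge1 alpha (a *m V) ->
  forall m, (d0 D (a 0 m) <= V)%MS.
Proof.
move=> DD DM freeV dV daV m.
have D0 i : D i 0 = 0 by apply: (addrI (D i 0)); rewrite -DD !addr0.
pose U := \matrix_m d0 D (a 0 m).
suff: (U <= V)%MS by move=> /row_subP/(_ m); rewrite rowK.
apply: alternating_pairing_sub => //; apply/matrixP=> i j.
have aVE k l : D k ((a *m V) 0 l) =
    (U^T *m V) k l + \sum_p a 0 p * D k (V p l).
  rewrite mxE (big_morph (D k) (DD k) (D0 k)) mxE -big_split; apply: eq_bigr => p _.
  by rewrite DM !mxE.
have UVC : (V^T *m U) i j = (U^T *m V) j i.
  by rewrite -[U in LHS]trmxK -trmx_mul mxE.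
have := congr1 (fun A : 'M_n => A i j) daV.
rewrite UVC [LHS]mxE [RHS]mxE !aVE [(a *m V) 0 i]mxE [(a *m V) 0 j]mxE.
have -> : alpha 0 i * \sum_p a 0 p * V p j - alpha 0 j * \sum_p a 0 p * V p i =
          \sum_p a 0 p * D i (V p j) - \sum_p a 0 p * D j (V p i).
  rewrite !mulr_sumr -!sumrB; apply: eq_bigr => p _.
  have := congr1 (fun A : 'M_n => A i j) (dV p); rewrite !mxE => e.
  by rewrite -mulrBr e; ring.
by rewrite opprD addrACA -[RHS]add0r => /addIr/subr0_eq.
Qed.

(** * Galois action on a matrix by constant matrices *)

(** Hence the matrix by which an automorphism acts on B is unique, which makes
the matrices chosen below for the single automorphisms multiplicative. *)
Lemma row_free_scalars_inj (C E : fieldType) (iota : {rmorphism C -> E}) (d n : nat)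
    (B : 'M[E]_(d, n)) (A1 A2 : 'M[C]_d) : row_free B ->
  map_mx iota A1 *m B = map_mx iota A2 *m B -> A1 = A2.
Proof. by move=> freeB /(row_free_inj freeB)/map_mx_inj. Qed.

(** Here C is any field inside the base field F0.  F is the fixed field of the
group N of the automorphisms which fix B; the hypothesis on all automorphisms
yields both that N is normal and that Gal(F / F0) acts by matrices over C. *)
Lemma faithful_galois_descent (F0 C : fieldType) (L : splittingFieldType F0)
    (iota : {rmorphism C -> F0}) (d n : nat) (B : 'M[L]_(d, n)) :
    galois 1%AS {:L}%AS -> row_free B ->
    (forall g : 'AEnd(L), exists A : 'M[C]_d,
       map_mx g B = map_mx (in_alg L \o iota) A *m B) ->
  exists F : {subfield L},
    [/\ galois 1%AS F, forall i j, B i j \in F &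
        exists2 rho : mx_representation C 'Gal(F / 1)%G d,
          forall sigma : gal_of F,
            map_mx sigma B = map_mx (in_alg L \o iota) (rho sigma) *m B &
          mx_faithful rho].
Proof.
move=> galL freeB actB.
pose iotaL : {rmorphism C -> L} := in_alg L \o iota.
pose act (g : 'AEnd(L)) (B' : 'M[L]_(d, n)) : 'M[L]_(d, n) :=
  @map_mx L L g d n B'.
have actE g B' i j : act g B' i j = g (B' i j) by rewrite mxE.
have act_iotaM (g : 'AEnd(L)) (A : 'M[C]_d) (B' : 'M[L]_(d, n)) :
    act g (map_mx iotaL A *m B') = map_mx iotaL A *m act g B'.
  rewrite /act map_mxM; congr (_ *m _).
  by apply/matrixP=> i j; rewrite !mxE /= linearZ rmorph1.
have actM (x y : gal_of {:L}) : act (x * y)%g B = act y (act x B).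
  by apply/matrixP=> i j; rewrite !actE galM ?memvf.
have {}actB (g : 'AEnd(L)) : exists A, act g B = map_mx iotaL A *m B.
  exact: actB.
pose N := [set sigma : gal_of {:L} | act sigma B == B].
have N_group : group_set N.
  apply/group_setP; split=> [|x y].
    by rewrite inE; apply/eqP/matrixP=> i j; rewrite actE gal_id.
  by rewrite !inE actM => /eqP-> /eqP->.
pose NG := Group N_group.
have galT (E : {subfield L}) (x : gal_of E) : x \in 'Gal(E / 1)%g.
  by rewrite gal_kHom ?sub1v // k1HomE ahomWin.
have nsNG : (NG <| 'Gal({:L} / 1))%g.
  apply/andP; split; first by apply/subsetP=> x _; apply: galT.
  apply/subsetP=> y _; rewrite inE; apply/subsetP=> _ /imsetP[x Nx ->].
  move: Nx; rewrite !inE conjgE actM => /eqP Bx.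
  (* x fixes B, hence also y^-1 B = A B, because A is over the base field;
     so the conjugate y^-1 x y fixes B. *)
  have [A BA] := actB (y^-1)%g.
  rewrite BA act_iotaM actM Bx -act_iotaM -BA -actM mulVg; apply/eqP/matrixP=> i j.
  by rewrite actE gal_id.
pose F : {subfield L} := [aspace of fixedField NG].
have B_F i j : B i j \in F.
  apply/(fixedFieldP (memvf _)) => x; rewrite inE => /eqP/matrixP/(_ i j).
  by rewrite actE.
have [rho rhoB] := fin_all_exists (fun sigma : gal_of F => actB sigma).
have rho_repr : mx_repr 'Gal(F / 1)%G rho.
  split=> [|x y _ _]; apply: (row_free_scalars_inj (iota := iotaL) freeB); rewrite -rhoB.
    rewrite map_mx1 mul1mx; apply/matrixP=> i j; rewrite actE; exact: gal_id.
  rewrite map_mxM -mulmxA -rhoB -act_iotaM -rhoB.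
  by apply/matrixP=> i j; rewrite !actE galM.
exists F; split=> //; first exact: normal_fixedField_galois.
exists (MxRepresentation rho_repr) => //=.
(* The function underlying x : gal_of F is an automorphism of all of L; if it
   fixes B then it belongs to N as an element of Gal(L / F0). *)
apply/subsetP=> x /rkerP[_ /= rho1]; apply/set1P/eqP/gal_eqP=> a Fa.
rewrite gal_id -(galK (subvf _) (memvf a) : gal {:L} x a = x a).
have [_] := mem_fixedFieldP Fa; apply; rewrite inE; apply/eqP/matrixP=> i j.
rewrite actE galK ?subvf ?memvf //.
by have /matrixP/(_ i j) := rhoB x; rewrite rho1 map_mx1 mul1mx actE.
Qed.

Lemma faithful_isog_GL (gT : finGroupType) (G : {group gT}) (C : fieldType) (d : nat)
    (rho : mx_representation C G d) : mx_faithful rho ->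
  exists2 H : {fset 'M[C]_d}, finite_GL_subgroup H & isog_GL_subgroup G H.
Proof.
move=> rho_inj; pose H := [fset rho x | x in G]%fset.
have HP A : A \in H <-> exists2 x, x \in G & A = rho x.
  by split=> [/imfsetP[x Gx ->]|[x Gx ->]]; [exists x | apply/imfsetP; exists x].
exists H; last first.
  exists rho; split=> //; first exact: repr_mxM.
  exact: (mx_faithful_inj rho_inj).
split=> [A /HP[x Gx ->]||A1 A2 /HP[x Gx ->] /HP[y Gy ->]|A /HP[x Gx ->]].
- exact: repr_mx_unit.
- by apply/HP; exists 1%g; rewrite ?repr_mx1.
- by apply/HP; exists (x * y)%g; rewrite ?groupM ?repr_mxM.
- by apply/HP; exists (x^-1)%g; rewrite ?groupV ?repr_mxV.
Qed.

(** * The blocks of images of omega *)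

(** The rows are indexed by the pairs (k, j) through [mxvec_index], so that the
matrix of an automorphism with respect to these rows is the one required by
[acts_on_basis]. *)
Definition basis_mx (E : fieldType) (n r q s : nat) (le_sq : (s <= q)%N)
    (w : 'I_r -> 'I_q -> 'rV[E]_n) : 'M[E]_(r * s, n) :=
  \matrix_(i, x) mxvec (\matrix_(k < r, j < s) w k (widen_ord le_sq j) 0 x) 0 i.

Lemma row_basis_mx (E : fieldType) (n r q s : nat) (le_sq : (s <= q)%N)
    (w : 'I_r -> 'I_q -> 'rV[E]_n) k j :
  row (mxvec_index k j) (basis_mx le_sq w) = w k (widen_ord le_sq j).
Proof. by apply/rowP=> x; rewrite !mxE mxvecE mxE. Qed.

Lemma mul_basis_mx (E : fieldType) (n r q s : nat) (le_sq : (s <= q)%N)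
    (w : 'I_r -> 'I_q -> 'rV[E]_n) (a : 'rV[E]_(r * s)) :
  a *m basis_mx le_sq w =
    \sum_(l < r) \sum_(m < s) a 0 (mxvec_index l m) *: w l (widen_ord le_sq m).
Proof.
rewrite mulmx_sum_row (reindex _ (curry_mxvec_bij _ _)) /= pair_bigA.
by apply: eq_bigr => -[l m] _ /=; rewrite row_basis_mx.
Qed.

(** The span of the rows is a direct sum of r spaces of dimension s. *)
Lemma basis_mx_free (F0 : fieldType) (L : splittingFieldType F0) (n r q s : nat)
    (le_sq : (s <= q)%N) (w : 'I_r -> 'I_q -> 'rV[L]_n) :
    (forall k, \rank (block_mx_span w k) = s) ->
    (forall k,
      (\matrix_(j < s) w k (widen_ord le_sq j) :=: block_mx_span w k)%MS) ->
    mxdirect (\sum_(k < r) <<block_mx_span w k>>)%MS ->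
  row_free (basis_mx le_sq w).
Proof.
move=> rank_w basis_w /mxdirectP /= rank_sum.
rewrite /row_free eqn_leq rank_leq_row /=.
have rank_rs :
    \rank (\sum_(k < r) <<block_mx_span w k>>)%MS = (r * s)%N.
  rewrite rank_sum (eq_bigr (fun=> s)) ?sum_nat_const ?card_ord // => k _.
  by rewrite genmxE.
apply: leq_trans (eq_leq (esym rank_rs)) _; apply/mxrankS/sumsmx_subP=> k _; rewrite genmxE -basis_w.
by apply/row_subP=> j; rewrite rowK -row_basis_mx row_sub.
Qed.

Lemma block_image (F0 : fieldType) (L : splittingFieldType F0) (n r q s : nat)
    (w : 'I_r -> 'I_q -> 'rV[L]_n) (D : 'I_n -> L -> L) (omega : 'rV[L]_n)
    (le_sq : (s <= q)%N) (blocks : block_setting w D omega le_sq)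
    (g : 'AEnd(L)) k j : exists k' j', map_mx g (w k j) = w k' j'.
Proof.
have [tau _ ->] :
    exists2 tau, tau \in 'Gal({:L} / 1)%g & w k j = gal_form tau omega.
  by apply/(block_images blocks); exists k, j.
have [k' [j' Dkj]] : exists k' j', gal_form (tau * gal {:L} g)%g omega = w k' j'.
  apply/(block_images blocks); exists (tau * gal {:L} g)%g => //.
  by rewrite gal_kHom ?sub1v // k1HomE ahomWin.
exists k', j'; rewrite -Dkj; apply/rowP=> x.
by rewrite !mxE galM ?memvf // galK ?subvf ?memvf.
Qed.

(** The coordinates a_m of w k j in the basis of its block satisfy
da_m /\ Omega = 0: each da_m lies in the span of the block, and all images of
omega are orthogonal to Omega, whose coefficients are fixed by the Galois
group. *)
Lemma block_constant_coordinates (R : realType) (n : nat)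
    (Omega : 'rV[ratfun R n]_n)
    (L : splittingFieldType (ratfun R n)) (D : 'I_n -> L -> L) (omega : 'rV[L]_n)
    (r q s : nat) (le_sq : (s <= q)%N) (w : 'I_r -> 'I_q -> 'rV[L]_n) :
    (~ exists phi : ratfun R n, rational_first_integral Omega phi) ->
    (forall i, extends_partial i (D i)) ->
    integrable_form D (map_mx (in_alg L) Omega) omega ->
    block_setting w D omega le_sq ->
  forall k j, exists c : 'I_s -> R[i],
    w k j = \sum_(m < s) (ratC n (c m))%:A *: w k (widen_ord le_sq m).
Proof.
move=> no_int extD [_ [_ [omega_Omega _ _]]] blocks k j.
have w_Omega k' j' : wedge_top (w k' j') (map_mx (in_alg L) Omega) = 0.
  have [tau _ ->] :
      exists2 tau, tau \in 'Gal({:L} / 1)%g & w k' j' = gal_form tau omega.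
    by apply/(block_images blocks); exists k', j'.
  rewrite -(rmorph0 tau) -omega_Omega /wedge_top rmorph_sum; apply: eq_bigr => i _.
  by rewrite !mxE !rmorphM rmorphXn rmorphN1 /= linearZ rmorph1.
pose V : 'M[L]_(s, n) := \matrix_(m < s) w k (widen_ord le_sq m).
have freeV : row_free V by rewrite /row_free (block_basis blocks k) (block_dim blocks).
have /submxP[a Da] : (w k j <= V)%MS.
  by rewrite (block_basis blocks k) -[w k j](rowK (w k)) row_sub.
have [alpha [_ _ dw]] := block_form blocks k.
have da m : wedge_top (d0 D (a 0 m)) (map_mx (in_alg L) Omega) = 0.
  apply: (@wedge_top_sub _ _ _ V) => [p|]; first by rewrite rowK.
  apply: (d0_coordinate_sub (alpha := alpha)) => // [i|i|p|].
  - by have [] := extD i.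
  - by have [] := extD i.
  - by rewrite rowK.
  - by rewrite -Da.
have [c Dc] :=
  fin_all_exists (fun m => constant_of_wedge_eq0 no_int extD (da m)).
by exists c; rewrite Da mulmx_sum_row; apply: eq_bigr => m _; rewrite Dc rowK.
Qed.

Theorem lemma11 (R : realType) (n : nat)
  (Omega : 'rV[ratfun R n]_n)
  (Omega_neq0 : Omega != 0)
  (no_first_integral :
     ~ exists phi : ratfun R n, rational_first_integral Omega phi)
  (L : splittingFieldType (ratfun R n))
  (galL : galois 1%AS {:L}%AS)
  (D : 'I_n -> L -> L)
  (extD : forall i, extends_partial i (D i))
  (omega : 'rV[L]_n)
  (omegaI : integrable_form D (map_mx (in_alg L) Omega) omega)
  (r q s : nat) (s_gt1 : (1 < s)%N) (le_sq : (s <= q)%N)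
  (w : 'I_r -> 'I_q -> 'rV[L]_n)
  (blocks : block_setting w D omega le_sq) :
  exists F : {subfield L},
    [/\ galois 1%AS F,
        form_over F omega,
        exists2 rho : mx_representation R[i] 'Gal(F / 1)%G (r * s),
          acts_on_basis w le_sq rho & mx_faithful rho &
        exists2 H : {fset 'M[R[i]]_(r * s)},
          finite_GL_subgroup H & isog_GL_subgroup 'Gal(F / 1)%G H].
Proof.
pose B := basis_mx le_sq w.
have freeB : row_free B.
  exact: basis_mx_free (block_dim blocks) (block_basis blocks)
           (block_direct blocks).
pose iota : {rmorphism R[i] -> ratfun R n} := @tofrac _ \o @mpolyC n R[i].
have actB (g : 'AEnd(L)) : exists A : 'M[R[i]]_(r * s),
    map_mx g B = map_mx (in_alg L \o iota) A *m B.
  have rowB i : exists c : 'rV_(r * s),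
      row i (map_mx g B) = map_mx (in_alg L \o iota) c *m B.
    case/mxvec_indexP: i => k j; rewrite -map_row row_basis_mx.
    have [k' [j' ->]] := block_image blocks g k (widen_ord le_sq j).
    have [c ->] :=
      block_constant_coordinates no_first_integral extD omegaI blocks k' j'.
    (* The image lies in the block k', so its coordinates on the other blocks
       vanish. *)
    exists (mxvec (\matrix_(l, m) (if l == k' then c m else 0))).
    rewrite mul_basis_mx (bigD1 k') //= [X in _ + X]big1 ?addr0 => [|l ne_l].
      by apply: eq_bigr => m _; rewrite mxE mxvecE mxE eqxx.
    by rewrite big1 // => m _; rewrite mxE mxvecE mxE (negPf ne_l) rmorph0 scale0r.
  have [c Bc] := fin_all_exists rowB.
  by exists (\matrix_i c i); apply/row_matrixP=> i; rewrite Bc row_mul -map_row rowK.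
have [F [galF F_B [rho rhoB rho_inj]]] :=
  faithful_galois_descent galL freeB actB.
exists F; split=> //; last exact: faithful_isog_GL rho_inj.
  have [k [j Dkj]] : exists k j, omega = w k j.
    apply/(block_images blocks); exists 1%g; first exact: group1.
    by apply/rowP=> x; rewrite mxE gal_id.
  have r_gt0 : (0 < r)%N by rewrite (leq_ltn_trans _ (ltn_ord k)).
  (* The first vector of the first block is omega, and it is a row of B. *)
  move=> x; pose j0 := Ordinal (ltnW s_gt1).
  rewrite -(block_first blocks (k := Ordinal r_gt0) (j := widen_ord le_sq j0)) //.
  by rewrite -row_basis_mx mxE F_B.
exists rho => // sigma _ k j.
rewrite /gal_form -row_basis_mx map_row rhoB row_mul -map_row mul_basis_mx.
by apply: eq_bigr => l _; apply: eq_bigr => m _; rewrite !mxE.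
Qed.
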